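(* Let $n\in\mathbb{N}$, $a>1$ and $\lambda>0$, let $(h_j(n))_{0\le j\le n}$ be a real-valued sequence with $\sup_{0\le j\le n}|h_j(n)|\le1$, and let $Z_j(n,a)$ be complex-valued coefficients. Let the input set be $\{z_j\}_{j=0}^n=\{-ih_j(n)\}_{j=0}^n$. Consider the problem of finding the output set $w_0,\dots,w_n$ such that the RBF superoscillations of the first type, respectively of the second type, solve the learning problem $$f_*=\arg\min_{f\in\mathcal{H}_{\sqrt2}(\mathbb{C})}J(f),\qquad J(f)=\sum_{k=0}^n|w_k-f(z_k)|^2+\lambda\|f\|^2,\quad f\in\mathcal{H}_{\sqrt2}(\mathbb{C}).$$ The components of the output set $\{w_k\}_{k=0}^n$ in this problem are given as follows. (i) For the RBF superoscillations of the first type: $$w_k=e^{\frac{h_k^2(n)}{2}}\sum_{j=0}^nZ_j(n,a)\,e^{-h_k(n)h_j(n)}+\lambda Z_k(n,a)\,e^{-\frac{h_k^2(n)}{2}}.$$ (ii) For the RBF superoscillations of the second type: $$w_k=e^{\frac{h_k^2(n)}{2}}\sum_{j=0}^nZ_j(n,a)\,e^{\frac{h_j^2(n)}{2}-h_k(n)h_j(n)}+\lambda Z_k(n,a).$$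
   Context: The RBF space $\mathcal{H}_{\sqrt2}(\mathbb{C})$ (width parameter $\gamma=\sqrt2$) is the Hilbert space of entire functions $f$ with $$\|f\|^2=\frac1\pi\int_{\mathbb{C}}|f(z)|^2\exp\left(\frac{(z-\overline z)^2}{2}\right)dA(z)<\infty,\qquad dA=dx\,dy,\ z=x+iy.$$ Its reproducing kernel is the Gaussian RBF kernel $K_{\sqrt2}(z,w)=\exp\left(-\frac{(z-\overline w)^2}{2}\right)$. The RBF superoscillations of the first type are $$r_n(z)=\sum_{j=0}^nZ_j(n,a)\,e^{-\frac{h_j^2(n)}{2}}K_{\sqrt2}(z,-ih_j(n)),$$ and the RBF superoscillations of the second type are $$s_n(z,a)=\sum_{j=0}^nZ_j(n,a)\,K_{\sqrt2}(z,-ih_j(n)).$$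
   Formalization: The exponent -h_k h_j in both formulas is corrected to +h_k h_j (as printed they fail, e.g. n=0, h_0=1, Z_0=1), and uniqueness of the output set is claimed only when the inputs z_k are pairwise distinct, since it fails otherwise. *)

(* Defs.v *)
From HB Require Import structures.
From mathcomp Require Import all_boot all_order all_algebra.
From mathcomp Require Import all_classical all_reals all_analysis.
From mathcomp Require Import complex.

Set Implicit Arguments.
Unset Strict Implicit.
Unset Printing Implicit Defensive.

Import Order.TTheory GRing.Theory Num.Theory.
Import numFieldNormedType.Exports.
Import ComplexField.Normc.

Local Open Scope classical_set_scope.
Local Open Scope ring_scope.
Local Open Scope complex_scope.

Section RBF.
Context {R : realType}.
Local Notation C := R[i].

Definition cexp (z : C) : C :=
  (expR (complex.Re z))%:C * (cos (complex.Im z) +i* sin (complex.Im z)).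

(* The scalar field of the normed module is C itself, so that derivability in
   the direction 1 is complex differentiability. *)
Definition entire (f : C -> C) : Prop :=
  forall z : C, derivable (f : C^o -> C^o) z 1.

(* (z - z^* )^2 / 2 is real, hence so is its exponential, and taking the real
   part only changes the type. *)
Definition rbf_weight (z : C) : R := complex.Re (cexp ((z - conjc z) ^+ 2 / 2)).

Definition rbf_esqnorm (f : C -> C) : \bar R :=
  ((pi^-1)%:E *
   \int[(@lebesgue_measure R \x @lebesgue_measure R)%E]_p
     (normc (f (p.1 +i* p.2)) ^+ 2 * rbf_weight (p.1 +i* p.2))%:E)%E.

Definition rbf_space : set (C -> C) :=
  [set f | entire f /\ (rbf_esqnorm f < +oo)%E].

Definition rbf_sqnorm (f : C -> C) : R := fine (rbf_esqnorm f).

Definition rbf_kernel (z w : C) : C := cexp (- ((z - conjc w) ^+ 2 / 2)).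

(* The point - i h_j(n), whose conjugate is + i h_j(n): hence
   rbf_kernel (rbf_point h n k) (rbf_point h n j) is
   exp ((h_k(n) + h_j(n))^2 / 2), with a plus sign in front of h_j(n). *)
Definition rbf_point (h : nat -> nat -> R) (n j : nat) : C := 0 -i* h j n.

Definition rbf_superosc1 (h : nat -> nat -> R) (Z : nat -> nat -> R -> C)
    (n : nat) (a : R) (z : C) : C :=
  \sum_(j < n.+1) Z j n a * (expR (- (h j n ^+ 2 / 2)))%:C
                  * rbf_kernel z (rbf_point h n j).

Definition rbf_superosc2 (h : nat -> nat -> R) (Z : nat -> nat -> R -> C)
    (n : nat) (a : R) (z : C) : C :=
  \sum_(j < n.+1) Z j n a * rbf_kernel z (rbf_point h n j).

Definition rbf_cost (n : nat) (lambda : R) (z w : 'I_n.+1 -> C)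
    (f : C -> C) : R :=
  \sum_(k < n.+1) normc (w k - f (z k)) ^+ 2 + lambda * rbf_sqnorm f.

End RBF.

Definition argmin_set (T : Type) (R : realType) (A : set T) (J : T -> R) :
    set T :=
  [set x | A x /\ forall y, A y -> J x <= J y].

(* f_* = argmin: f_* is the one and only minimizer. *)
Definition solves_learning_problem (R : realType) (n : nat) (lambda : R)
    (z w : 'I_n.+1 -> R[i]) (f : R[i] -> R[i]) : Prop :=
  argmin_set rbf_space (rbf_cost lambda z w) = [set f].

(* Main.v *)
From HB Require Import structures.
Require Import Defs.
From mathcomp Require Import all_boot all_order all_algebra.
From mathcomp Require Import all_classical all_reals all_analysis.
From mathcomp Require Import complex.
From mathcomp Require Import measurable_realfun ring lra.

(** Both superoscillations are combinations [f = \sum_j c_j K(., z_j)] of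
reproducing kernels, with [c_j = Z_j e^{- h_j^2 / 2}] and [c_j = Z_j]
respectively, and the theorem is the representer theorem read backwards: the
reproducing property gives, for every [g] in the RBF space,
[[
J(f + g) = J(f) - 2 Re (\sum_k conj(w_k - f(z_k) - lambda c_k) g(z_k))
           + \sum_k |g(z_k)|^2 + lambda |g|^2
]]
([rbf_cost_expand]).  If [w_k = f(z_k) + lambda c_k] the linear term vanishes
and the quadratic one is positive for [g <> 0], so [f] is the only minimizer
([kernel_comb_minimizes]).  Conversely, if [f] is a minimizer the linear term
must vanish for all [g]; when the points are distinct so are the numbers
[e^{i z_k} = e^{h_k}], and some [g] in the space takes prescribed values at the
points ([rbf_interpolation]), so every coefficient
[w_k - f(z_k) - lambda c_k] is zero ([kernel_comb_outputs_unique]).  The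
formulas for [w_k] are [f(z_k) + lambda c_k] with
[K(z_k, z_j) = e^{h_k^2 / 2} e^{h_j^2 / 2} e^{h_k h_j}].

The analytic content is the reproducing property
[<f, K(., w)> = f(w)] ([rbf_ip_kernel]).  After the translation [z = w + u]
the integrand becomes [F(u) e^{- |u|^2}] with
[F(u) = f(w + u) e^{u^2 / 2 + 2 i Im(w) u}] entire and [F(0) = f(w)], so what
has to be shown is that the Gaussian average of an integrable entire function
is its value at the origin ([gaussian_mean]).  Area is rotation invariant,
hence by Fubini the integrand may be replaced by its average over circles
([rotation_average]), which is [F(0)] by the mean value property
([mean_value]).

An entire function is only assumed to be complex differentiable, without
continuity of the derivative, so the mean value property goes through
Goursat's bisection argument: Cauchy's theorem holds on rectangles
([goursat]); applied to the function [zeta |-> F(u e^zeta)] on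
[[s, 0] x [0, 2 pi]], where the horizontal sides cancel by periodicity, it
shows that the average of [F] over the circle of radius [|u| e^s] does not
depend on [s <= 0].  Rotation invariance of area holds because a rotation is a
product of three shears, and shears preserve area slice by slice. *)

Import Order.TTheory GRing.Theory Num.Theory.
Import numFieldNormedType.Exports.
Import ComplexField.Normc.
Local Open Scope classical_set_scope.
Local Open Scope ring_scope.
Local Open Scope complex_scope.

Set Implicit Arguments.
Unset Strict Implicit.
Unset Printing Implicit Defensive.

(** * Entire functions *)

Section entire.
Context {R : realType}.
Local Notation C := R[i].
Implicit Types (f g : C -> C) (z u w : C).

Lemma complex_ext z w :
  complex.Re z = complex.Re w -> complex.Im z = complex.Im w -> z = w.
Proof. by case: z w => [a b] [c d] /= -> ->. Qed.

Lemma normr_normc z : `|z| = (normc z)%:C. Proof. by []. Qed.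

Lemma normc_sqr z : normc z ^+ 2 = complex.Re z ^+ 2 + complex.Im z ^+ 2.
Proof. by case: z => a b /=; rewrite sqr_sqrtr// addr_ge0// sqr_ge0. Qed.

Lemma normc_ge0 z : 0 <= normc z. Proof. by case: z => a b; exact: sqrtr_ge0. Qed.

Lemma ler_Re_normc z : `|complex.Re z| <= normc z.
Proof.
by rewrite -ler_sqr ?nnegrE ?normc_ge0// real_normK ?num_real// normc_sqr lerDl
  sqr_ge0.
Qed.

Lemma ler_Im_normc z : `|complex.Im z| <= normc z.
Proof.
by rewrite -ler_sqr ?nnegrE ?normc_ge0// real_normK ?num_real// normc_sqr lerDr
  sqr_ge0.
Qed.

Lemma ler_normc_ReIm z : normc z <= `|complex.Re z| + `|complex.Im z|.
Proof.
rewrite -ler_sqr ?nnegrE ?normc_ge0 ?addr_ge0 ?normr_ge0// normc_sqr.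
rewrite -[complex.Re z ^+ 2]real_normK ?num_real// -[complex.Im z ^+ 2]real_normK ?num_real//.
have := normr_ge0 (complex.Re z); have := normr_ge0 (complex.Im z). nra.
Qed.

(** Derivability over [C] is quantified by complex tolerances; this form
with real ones, where the increment [u] may vanish, is what the estimates
below use. *)
Lemma entireP f : entire f <->
  forall z, exists d, forall e : R, 0 < e -> exists2 r : R, 0 < r &
    forall u, normc u < r -> normc (f (z + u) - f z - d * u) <= e * normc u.
Proof.
split=> [fe z|fe z].
- have := fe z; rewrite /derivable => /cvg_ex[/= d dl]; exists d => e e0.
  move/cvgrPdist_le : dl => /(_ e%:C); rewrite ltcR => /(_ e0) [[r ri]/=].
  rewrite ltcE/= => /andP[/eqP ri0 r0] H.
  rewrite /= in ri0; exists r => // u ur.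
  have [->|u0] := eqVneq u 0; first by rewrite addr0 subrr mulr0 subrr normc0 mulr0.
  have := H u; rewrite /= sub0r normrN normr_normc ltcE/= ri0 eqxx/= => /(_ ur u0).
  rewrite normr_normc lecR => Hu.
  have nu0 : 0 < normc u.
    by rewrite lt_neqAle normc_ge0 eq_sym andbT; apply: contra_neq u0 => /eq0_normc.
  rewrite -ler_pdivrMr// -(normcV) -normcM.
  move: Hu; rewrite -normcN; congr (normc _ <= _).
  rewrite /GRing.scale/= !mulr1 (addrC u) mulrBl mulfK// opprB mulrC addrC.
  by rewrite mulrC.
- have [d H] := fe z.
  apply/cvg_ex; exists d => /=; apply/cvgrPdist_le => e; rewrite ltcE => /andP[/eqP ei e0].
  have [r r0 {}H] := H _ e0.
  exists (r%:C) => /=; first by rewrite ltcR.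
  move=> u /=; rewrite sub0r normrN normr_normc ltcR => ur u0.
  have nu0 : 0 < normc u.
    by rewrite lt_neqAle normc_ge0 eq_sym andbT; apply: contra_neq u0 => /eq0_normc.
  have := H _ ur; rewrite -ler_pdivrMr// -normcV -normcM => Hu.
  rewrite normr_normc lecE/= ei eqxx/=; move: Hu; rewrite -normcN; congr (normc _ <= _).
  rewrite /GRing.scale/= !mulr1 (addrC u) mulrBl mulfK// opprB mulrC addrC.
  by rewrite addrC.
Qed.

Lemma entire_cst w : entire (fun=> w).
Proof. by move=> z; exact: derivable_cst. Qed.

Lemma entire_id : entire (fun z => z).
Proof. by move=> z; exact: derivable_id. Qed.

Lemma entireD f g : entire f -> entire g -> entire (fun z => f z + g z).
Proof. by move=> fe ge z; exact: (derivableD (fe z) (ge z)). Qed.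

Lemma entireM f g : entire f -> entire g -> entire (fun z => f z * g z).
Proof. by move=> fe ge z; exact: (derivableM (fe z) (ge z)). Qed.

Lemma entire_comp f g : entire f -> entire g -> entire (f \o g).
Proof.
move=> fe ge z; apply/derivable1_diffP.
have /derivable1_diffP dg := ge z; have /derivable1_diffP df := fe (g z).
exact: (differentiable_comp dg df).
Qed.

Lemma cexpD z w : cexp (z + w) = cexp z * cexp w.
Proof.
case: z w => [a b] [c d]; rewrite /cexp /= expRD cosD sinD.
by apply/eqP; rewrite eq_complex /=; apply/andP; split; apply/eqP; ring.
Qed.

Lemma cexpR (x : R) : cexp x%:C = (expR x)%:C.
Proof. by rewrite /cexp /= cos0 sin0 mulr1. Qed.

Lemma cexp0 : cexp 0 = 1 :> C.
Proof. by rewrite (cexpR 0) expR0. Qed.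

Lemma normc_cexp z : normc (cexp z) = expR (complex.Re z).
Proof.
apply/eqP; rewrite -(@eqrXn2 _ 2)// ?normc_ge0 ?expR_ge0//; apply/eqP.
rewrite normc_sqr; case: z => a b /=.
rewrite mul0r subr0 mul0r addr0 !exprMn -mulrDr cos2Dsin2 mulr1//.
Qed.

Lemma cexp_conj z : conjc (cexp z) = cexp (conjc z).
Proof.
case: z => a b; rewrite /cexp/= cosN sinN.
by apply/eqP; rewrite eq_complex /=; apply/andP; split; apply/eqP; ring.
Qed.

Lemma derivable0_approx (f : R -> R) (d : R) : is_derive (0 : R) (1 : R) f d ->
  forall e, 0 < e -> exists2 r, 0 < r &
    forall x, `|x| < r -> `|f x - f 0 - d * x| <= e * `|x|.
Proof.
move=> [fd fe] e e0.
have : h^-1 *: (f (h *: 1 + 0) - f 0) @[h --> 0^'] --> d by rewrite -fe.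
move/cvgrPdist_le => /(_ e e0)[r /= r0 H]; exists r => // x xr.
have [->|x0] := eqVneq x 0; first by rewrite mulr0 subrr subr0 normr0 mulr0.
have := H x; rewrite /= sub0r normrN => /(_ xr x0).
rewrite -ler_pdivrMr ?normr_gt0// -normfV -normrM distrC.
congr (`| _ | <= _); rewrite /GRing.scale/= mulr1 addr0 [RHS]mulrBl mulfK//.
by rewrite mulrC.
Qed.

(** By the addition formula it is enough to expand at the origin, where
the expansion splits into those of the real functions [expR], [cos] and
[sin]. *)
Lemma entire_cexp : entire (@cexp R).
Proof.
apply/entireP => z; exists (cexp z) => e e0.
suff [r r0 H] : exists2 r : R, 0 < r & forall u, normc u < r ->
    normc (cexp u - 1 - u) <= (e / expR (complex.Re z)) * normc u.
  exists r => // u /H; rewrite mulrAC ler_pdivlMr ?expR_gt0// => Hu.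
  rewrite cexpD (_ : _ - _ = cexp z * (cexp u - 1 - u)); last by ring.
  by rewrite normcM normc_cexp mulrC.
have {e0} : 0 < e / expR (complex.Re z) by rewrite divr_gt0// expR_gt0.
move: (e / _) => {}e e0.
have e40 : 0 < Num.min (e / 8) 1 by rewrite lt_min ltr01 divr_gt0.
have [r1 r10 H1] := derivable0_approx (is_derive_expR 0) e40.
have [r2 r20 H2] := derivable0_approx (is_derive_cos 0) e40.
have [r3 r30 H3] := derivable0_approx (is_derive_sin 0) e40.
exists (Num.min r1 (Num.min r2 (Num.min r3 (Num.min (e/8) 1)))).
  by rewrite !lt_min r10 r20 r30 -lt_min.
case=> x y; set m := normc _; rewrite !lt_min => /and5P[m1 m2 m3 m4 m5].
have xm : `|x| <= m := ler_Re_normc (x +i* y).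
have ym : `|y| <= m := ler_Im_normc (x +i* y).
have := H1 _ (le_lt_trans xm m1); have := H2 _ (le_lt_trans ym m2).
have := H3 _ (le_lt_trans ym m3).
rewrite cos0 sin0 expR0 subr0 oppr0 mul1r mul0r subr0 mul1r.
set q := Num.min _ _ => Hs Hc He.
have q8 : q <= e/8 by rewrite /q ge_min lexx.
have q1 : q <= 1 by rewrite /q ge_min lexx orbT.
have cy1 : `|cos y| <= 1 by rewrite ler_norml cos_geN1 cos_le1.
have sy1 : `|sin y| <= 1 by rewrite ler_norml sin_geN1 sin_le1.
have sy2 : `|sin y| <= 2 * m.
  rewrite (_ : sin y = (sin y - y) + y); last by ring.
  rewrite (le_trans (ler_normD _ _))//.
  have := normr_ge0 y; nra.
have m0 : 0 <= m := normc_ge0 _.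
have ex2 : `|expR x - 1| <= 2 * m.
  rewrite (_ : expR x - 1 = (expR x - 1 - x) + x); last by ring.
  rewrite (le_trans (ler_normD _ _))//.
  have := normr_ge0 x; nra.
rewrite (le_trans (ler_normc_ReIm _))// /cexp/=.
rewrite (_ : _ - x = (expR x - 1 - x) * cos y + (1 + x) * (cos y - 1)); last by ring.
rewrite (_ : _ - y = (expR x - 1) * sin y + (sin y - y)); last by ring.
have h1 : `|(expR x - 1 - x) * cos y| <= e / 8 * m.
  rewrite normrM; have := normr_ge0 (expR x - 1 - x); have := normr_ge0 (cos y).
  have := normr_ge0 x; nra.
have h2 : `|(1 + x) * (cos y - 1)| <= 2 * (e / 8 * m).
  have x2 : `|1 + x| <= 2 by rewrite (le_trans (ler_normD _ _))// normr1; lra.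
  rewrite normrM ler_pM//; have := normr_ge0 y; nra.
have h3 : `|(expR x - 1) * sin y| <= (2 * m) * (2 * (e / 8)).
  rewrite normrM ler_pM// (le_trans sy2)//; lra.
have h4 : `|sin y - y| <= e / 8 * m by have := normr_ge0 y; nra.
have := ler_normD ((expR x - 1 - x) * cos y) ((1 + x) * (cos y - 1)).
have := ler_normD ((expR x - 1) * sin y) (sin y - y).
nra.
Qed.

End entire.

Section continuity.
Context {R : realType}.
Local Notation C := R[i].
Implicit Types (f g : C -> C) (z u w : C).

Lemma entire_continuous f : entire f -> forall z (e : R), 0 < e ->
  exists2 r : R, 0 < r & forall u, normc u < r -> normc (f (z + u) - f z) <= e.
Proof.
move=> /entireP fe z e e0; have [d /(_ _ ltr01) [r r0 H]] := fe z.
have d0 : 0 < 1 + normc d by rewrite ltr_pwDl// normc_ge0.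
exists (Num.min r (e / (1 + normc d))); first by rewrite lt_min r0 divr_gt0.
move=> u; rewrite lt_min ltr_pdivlMr// => /andP[ur ue].
rewrite (_ : _ - _ = (f (z + u) - f z - d * u) + d * u); last by ring.
rewrite (le_trans (le_normcD _ _))// normcM.
have := H _ ur; nra.
Qed.

Lemma entireZ w f : entire f -> entire (fun z => w * f z).
Proof. by move=> fe; exact: (entireM (@entire_cst R w) fe). Qed.

Lemma continuous_Re_horizontal f y : entire f ->
  continuous (fun x : R => complex.Re (f (x +i* y))).
Proof.
move=> fe x; apply/cvgrPdist_le => e e0.
have [r r0 H] := entire_continuous fe (x +i* y) e0.
exists r => // t /=; rewrite distrC => xt.
have := H ((t - x) +i* 0); rewrite /= expr0n/= addr0 sqrtr_sqr => /(_ xt).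
rewrite (_ : (x +i* y) + ((t - x) +i* 0) = t +i* y); last first.
  by apply/eqP; rewrite eq_complex/=; apply/andP; split; apply/eqP; ring.
move=> Hn; rewrite distrC (le_trans _ Hn)// (le_trans _ (ler_Re_normc _))//.
by case: (f _) (f _) => [? ?] [].
Qed.

Lemma continuous_Re_vertical f x : entire f ->
  continuous (fun y : R => complex.Re (f (x +i* y))).
Proof.
move=> fe.
have := @continuous_Re_horizontal (fun z => f ('i * z)) (- x).
rewrite (_ : (fun y => complex.Re (f (x +i* y))) =
  (fun y => complex.Re (f ('i * (y +i* (- x)))))).
  apply; exact: (entire_comp fe (@entireZ _ _ (@entire_id R))).
apply/funext => y; congr (complex.Re (f _)).
by apply/eqP; rewrite eq_complex/=; apply/andP; split; apply/eqP; ring.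
Qed.

(** Statements about imaginary parts of entire functions follow from
those about real parts, since multiplying by [- 'i] preserves entireness. *)
Lemma Im_as_Re z : complex.Im z = complex.Re (- 'i * z).
Proof. by case: z => a b /=; ring. Qed.

Lemma continuous_Im_horizontal f y : entire f ->
  continuous (fun x : R => complex.Im (f (x +i* y))).
Proof.
move=> fe; under eq_fun do rewrite Im_as_Re.
exact: (continuous_Re_horizontal (entireZ fe)).
Qed.

End continuity.

(** * Cauchy's theorem on rectangles and the mean value property *)

Section mean_value.
Context {R : realType}.
Local Notation C := R[i].
Implicit Types (f g : C -> C) (z u w : C).
Local Notation mu := (@lebesgue_measure R).

Lemma integrable_itv (h : R -> R) a b : continuous h ->
  mu.-integrable `[a, b] (EFin \o h).
Proof.
move=> hc; apply: continuous_compact_integrable; first exact: segment_compact.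
exact: continuous_subspaceT.
Qed.

Lemma Rintegral_itv_cat (h : R -> R) a m b : continuous h -> a <= m -> m <= b ->
  \int[mu]_(x in `[a, b]) h x =
  \int[mu]_(x in `[a, m]) h x + \int[mu]_(x in `[m, b]) h x.
Proof.
move=> hc am mb; apply/esym/eqP; rewrite addrC eq_sym -subr_eq; apply/eqP.
rewrite Rintegral_itvB ?bnd_simp//; last exact: integrable_itv.
rewrite Rintegral_itv_obnd_cbnd//.
apply: integrableS (integrable_itv m b hc) => //.
exact: subset_itv_oc_cc.
Qed.

Lemma Rintegral_itv_approx (h : R -> R) a b k M : continuous h -> a <= b ->
  (forall x, a <= x <= b -> `|h x - k| <= M) ->
  `|\int[mu]_(x in `[a, b]) h x - k * (b - a)| <= M * (b - a).
Proof.
move=> hc ab hk.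
have kE (l : R) : \int[mu]_(x in `[a, b]) l = l * (b - a).
  rewrite Rintegral_cst//= lebesgue_measure_itv/= lte_fin.
  by case: ltP => //= ba; rewrite (le_anti (introT andP (conj ab ba))) subrr.
rewrite -!kE -RintegralB//; [|exact: integrable_itv|];
  last by apply: integrable_itv; exact: cst_continuous.
have ci : continuous (fun x => h x - k).
  by move=> x; apply: cvgB; [exact: hc|exact: cvg_cst].
rewrite (le_trans (le_normr_Rintegral _ _))//; first exact: integrable_itv.
apply: le_Rintegral => //.
- apply: integrable_itv => x; apply: cvg_norm; exact: ci.
- apply: integrable_itv; exact: cst_continuous.
Qed.

(** Goursat's bisection, for an abstract function [E] of rectangles that
is additive under vertical and horizontal cuts.  If [E] does not vanish on
some rectangle, one of its quarters carries at least a quarter of [|E|];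
iterating, similar rectangles shrink to a point near which [E] is not small
compared with the square of their size. *)
Lemma rectangle_function_eq0 (E : R -> R -> R -> R -> R) :
  (forall a m b c d, a <= m -> m <= b -> E a b c d = E a m c d + E m b c d) ->
  (forall a b c m d, c <= m -> m <= d -> E a b c d = E a b c m + E a b m d) ->
  (forall x y e, 0 < e -> exists2 r, 0 < r & forall a b c d,
    a <= x <= b -> c <= y <= d -> b - a < r -> d - c < r ->
    `|E a b c d| <= e * (b - a + (d - c)) ^+ 2) ->
  forall a b c d, a <= b -> c <= d -> E a b c d = 0.
Proof.
move=> Eh Ev El a b c d ab cd.
have [//|E0] := eqVneq (E a b c d) 0; exfalso.
move: E0; rewrite -normr_gt0 => E0.
set eta := `|E a b c d| in E0.
pose r k : R := 2^-1 ^+ k.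
have r0 k : 0 < r k by rewrite exprn_gt0// invr_gt0.
have rS k : r k.+1 = r k / 2 by rewrite /r exprSr.
set L := b - a; set L' := d - c.
have L0 : 0 <= L by rewrite subr_ge0.
have L'0 : 0 <= L' by rewrite subr_ge0.
(* At step k the side lengths are L * r k and L' * r k, and p is the lower left
   corner. *)
pose bad k (p : R * R) :=
  eta * (r k) ^+ 2 <= `|E p.1 (p.1 + L * r k) p.2 (p.2 + L' * r k)|.
have step (t : nat * (R * R)) : exists p : R * R, bad t.1 t.2 ->
    [/\ t.2.1 <= p.1, p.1 + L * r t.1.+1 <= t.2.1 + L * r t.1,
        t.2.2 <= p.2, p.2 + L' * r t.1.+1 <= t.2.2 + L' * r t.1 & bad t.1.+1 p].
  case: t => k [x y] /=.
  have [bk|nb] := boolP (`[<bad k (x, y)>]); last first.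
    by exists (x, y) => /asboolP; rewrite (negbTE nb).
  move/asboolP : bk => bk.
  suff [p ?] : exists p : R * R, [/\ x <= p.1, p.1 + L * r k.+1 <= x + L * r k,
        y <= p.2, p.2 + L' * r k.+1 <= y + L' * r k & bad k.+1 p] by exists p.
  set X := L * r k.+1; set Y := L' * r k.+1.
  have X2 : L * r k = X + X by rewrite /X rS; field.
  have Y2 : L' * r k = Y + Y by rewrite /Y rS; field.
  have X0 : 0 <= X by rewrite mulr_ge0// ltW.
  have Y0 : 0 <= Y by rewrite mulr_ge0// ltW.
  move: bk; rewrite /bad /= -/X -/Y X2 Y2.
  rewrite (Eh x (x + X))// ?lerDl ?addrA ?lerDl//.
  rewrite (Ev x _ y (y + Y))// ?addrA ?lerDl//.
  rewrite (Ev (x + X) _ y (y + Y))// ?addrA ?lerDl//.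
  move=> bk.
  have : eta * r k.+1 ^+ 2 <= `|E x (x + X) y (y + Y)| \/
     eta * r k.+1 ^+ 2 <= `|E x (x + X) (y + Y) (y + Y + Y)| \/
     eta * r k.+1 ^+ 2 <= `|E (x + X) (x + X + X) y (y + Y)| \/
     eta * r k.+1 ^+ 2 <= `|E (x + X) (x + X + X) (y + Y) (y + Y + Y)|.
    apply: contrapT => /not_orP[/negP + /not_orP[/negP + /not_orP[/negP + /negP]]].
    rewrite -!ltNge => h1 h2 h3 h4.
    move: bk; apply/negP; rewrite -ltNge.
    move: h1 h2 h3 h4; move: (E _ _ _ _) (E _ _ _ _) (E _ _ _ _) (E _ _ _ _).
    move=> e1 e2 e3 e4 h1 h2 h3 h4.
    have := ler_normD (e4 + e3 + e2) e1.
    have := ler_normD (e4 + e3) e2; have := ler_normD e4 e3.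
    have -> : eta * r k ^+ 2 = 4 * (eta * r k.+1 ^+ 2) by rewrite rS; field.
    lra.
  case=> [h|[h|[h|h]]].
  - by exists (x, y); split => //=; lra.
  - by exists (x, y + Y); split => //=; lra.
  - by exists (x + X, y); split => //=; lra.
  - by exists (x + X, y + Y); split => //=; lra.
have [F HF] := choice step.
pose p := fix p k := if k is k'.+1 then F (k', p k') else (a, c).
have badp k : bad k (p k).
  elim: k => [|k IH]; last by have [] := HF (k, p k) IH.
  by rewrite /bad/= /r expr0 !mulr1 expr1n mulr1 /L /L' !subrKC.
have stepp k : [/\ (p k).1 <= (p k.+1).1,
   (p k.+1).1 + L * r k.+1 <= (p k).1 + L * r k,
   (p k).2 <= (p k.+1).2 & (p k.+1).2 + L' * r k.+1 <= (p k).2 + L' * r k].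
  by have [] := HF (k, p k) (badp k).
have nest (q : nat -> R) (l : R) : 0 <= l ->
    (forall k, q k <= q k.+1 /\ q k.+1 + l * r k.+1 <= q k + l * r k) ->
    exists x, forall k, q k <= x <= q k + l * r k.
  move=> l0 H.
  have qm m k : q k <= q (k + m)%N /\ q (k + m)%N + l * r (k + m)%N <= q k + l * r k.
    elim: m => [|m [IH1 IH2]]; first by rewrite addn0.
    rewrite addnS; have [h1 h2] := H (k + m)%N.
    by split; [exact: le_trans h1|exact: le_trans IH2].
  have ub k j : q j <= q k + l * r k.
    have [jk|kj] := leqP j k.
      rewrite -(subnKC jk); have [h _] := qm (k - j)%N j.
      by rewrite (le_trans h)// lerDl mulr_ge0// ltW.
    rewrite -(subnKC (ltnW kj)); have [_ h] := qm (j - k)%N k.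
    by rewrite (le_trans _ h)// lerDl mulr_ge0// ltW.
  exists (sup (range q)) => k; apply/andP; split.
    apply: ub_le_sup; last by exists k.
    by exists (q 0%N + l * r 0%N) => _ [j _ <-].
  by apply: ge_sup; [exists (q 0%N), 0%N|move=> _ [j _ <-]].
have [x Hx] : exists x, forall k, (p k).1 <= x <= (p k).1 + L * r k.
  by apply: (nest (fun k => (p k).1)) => // k; have [] := stepp k.
have [y Hy] : exists y, forall k, (p k).2 <= y <= (p k).2 + L' * r k.
  by apply: (nest (fun k => (p k).2)) => // k; have [] := stepp k.
(* This tolerance makes the local bound strictly less than eta * r k ^+ 2. *)
pose e := eta / (2 * ((L + L') ^+ 2 + 1)).
have S0 : 0 < 2 * ((L + L') ^+ 2 + 1) by have := sqr_ge0 (L + L'); lra.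
have e0 : 0 < e by rewrite divr_gt0.
have [s s0 Hs] := El x y e e0.
have [k Hk] : exists k, (L + L') * r k < s.
  have : (L + L') * r k @[k --> \oo] --> (L + L') * 0.
    by apply: cvgMr; apply: cvg_expr; rewrite ger0_norm; lra.
  rewrite mulr0 => /cvgrPdist_lt /(_ s s0) [N _ /(_ N (leqnn N))].
  rewrite /= sub0r normrN ger0_norm; first by exists N.
  by apply: mulr_ge0; [exact: addr_ge0|exact: ltW].
have Lr : 0 <= L * r k by rewrite mulr_ge0// ltW.
have Lr' : 0 <= L' * r k by rewrite mulr_ge0// ltW.
have := Hs (p k).1 ((p k).1 + L * r k) (p k).2 ((p k).2 + L' * r k) (Hx k) (Hy k).
rewrite (_ : (p k).1 + L * r k - (p k).1 = L * r k); last by ring.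
rewrite (_ : (p k).2 + L' * r k - (p k).2 = L' * r k); last by ring.
have L1 : L * r k < s by rewrite mulrDl in Hk; lra.
have L2 : L' * r k < s by rewrite mulrDl in Hk; lra.
move=> /(_ L1 L2) h2.
have := le_trans (badp k) h2; apply/negP; rewrite -ltNge.
rewrite -mulrDl exprMn mulrA ltr_pM2r ?exprn_gt0//.
rewrite /e mulrAC ltr_pdivrMr// ltr_pM2l//.
have := sqr_ge0 (L + L'); lra.
Qed.

(** The imaginary part of the integral of [f] along the boundary of
[[a, b] x [c, d]], run counterclockwise.  The real part is this quantity for
['i * f]. *)
Definition im_contour f (a b c d : R) : R :=
  \int[mu]_(x in `[a, b]) (complex.Im (f (x +i* c)) - complex.Im (f (x +i* d))) +
  \int[mu]_(y in `[c, d]) (complex.Re (f (b +i* y)) - complex.Re (f (a +i* y))).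

(** Near a point, [f] is an affine function, whose contour integral is
zero, up to an error negligible with respect to the distance to that point;
the contour integral is therefore negligible with respect to the square of the
size of the rectangle. *)
Lemma goursat f a b c d : entire f -> a <= b -> c <= d ->
  im_contour f a b c d = 0.
Proof.
move=> fe.
have cH c1 d1 : continuous (fun x =>
    complex.Im (f (x +i* c1)) - complex.Im (f (x +i* d1))).
  by move=> x; apply: cvgB; exact: continuous_Im_horizontal.
have cV a1 b1 : continuous (fun y =>
    complex.Re (f (b1 +i* y)) - complex.Re (f (a1 +i* y))).
  by move=> y; apply: cvgB; exact: continuous_Re_vertical.
have cIm y : continuous (fun x => complex.Im (f (x +i* y))).
  exact: continuous_Im_horizontal.
have cRe x : continuous (fun y => complex.Re (f (x +i* y))).
  exact: continuous_Re_vertical.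
apply: rectangle_function_eq0.
- move=> {a b c d} a m b c d am mb; rewrite /im_contour.
  rewrite (Rintegral_itv_cat _ am mb)//.
  rewrite (RintegralB _ (integrable_itv _ _ (cRe b)) (integrable_itv _ _ (cRe a)))//.
  rewrite (RintegralB _ (integrable_itv _ _ (cRe m)) (integrable_itv _ _ (cRe a)))//.
  rewrite (RintegralB _ (integrable_itv _ _ (cRe b)) (integrable_itv _ _ (cRe m)))//.
  ring.
- move=> {a b c d} a b c m d cm md; rewrite /im_contour.
  rewrite (@Rintegral_itv_cat (fun y => complex.Re (f (b +i* y)) - _) c m d)//.
  rewrite (RintegralB _ (integrable_itv _ _ (cIm c)) (integrable_itv _ _ (cIm d)))//.
  rewrite (RintegralB _ (integrable_itv _ _ (cIm c)) (integrable_itv _ _ (cIm m)))//.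
  rewrite (RintegralB _ (integrable_itv _ _ (cIm m)) (integrable_itv _ _ (cIm d)))//.
  ring.
- move=> {a b c d} x y e e0.
  have e20 : 0 < e / 2 by rewrite divr_gt0.
  have /entireP/(_ (x +i* y))[k /(_ _ e20)[r r0 H]] := fe.
  exists (r / 2); first by rewrite divr_gt0.
  move=> a b c d /andP[ax xb] /andP[cy yd] bar dcr.
  set D := b - a + (d - c).
  have D0 : 0 <= D by rewrite /D; lra.
  have near s t : a <= s <= b -> c <= t <= d ->
      normc (f (s +i* t) - f (x +i* y) - k * ((s - x) +i* (t - y))) <= e / 2 * D.
    move=> /andP[as_ sb] /andP[ct td].
    have uD : normc ((s - x) +i* (t - y)) <= D.
      rewrite (le_trans (ler_normc_ReIm _))//= /D.
      by rewrite lerD// ler_norml; lra.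
    have := H ((s - x) +i* (t - y)).
    rewrite (_ : (x +i* y) + _ = s +i* t); last first.
      by apply: complex_ext => /=; ring.
    move=> Hs; rewrite (le_trans (Hs _))//.
      by rewrite (le_lt_trans uD)// /D; lra.
    by rewrite ler_pM2l.
  have h1 : `|\int[mu]_(x in `[a, b])
        (complex.Im (f (x +i* c)) - complex.Im (f (x +i* d)))
      - complex.Re k * (c - d) * (b - a)| <= e * D * (b - a).
    apply: Rintegral_itv_approx => //; first lra.
    move=> s sab.
    have n1 := near s c sab; have n2 := near s d sab.
    have {}n1 h := le_trans (ler_Im_normc _) (n1 h).
    have {}n2 h := le_trans (ler_Im_normc _) (n2 h).
    move: n1 n2; case: (f _) (f _) (f _) => [p1 q1] [p2 q2] [p3 q3] /=.
    case: (k) => k1 k2 /= n1 n2.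
    have cc : c <= c <= d by rewrite lexx ?andbT (le_trans cy yd).
    have dd : c <= d <= d by rewrite lexx ?andbT (le_trans cy yd).
    have := lerD (n1 cc) (n2 dd).
    rewrite (_ : e / 2 * D + e / 2 * D = e * D); last by field.
    apply: le_trans; rewrite (le_trans _ (ler_normB _ _))// le_eqVlt; apply/orP; left.
    by apply/eqP; congr (`| _ |); ring.
  have h2 : `|\int[mu]_(y in `[c, d])
        (complex.Re (f (b +i* y)) - complex.Re (f (a +i* y)))
      - complex.Re k * (b - a) * (d - c)| <= e * D * (d - c).
    apply: Rintegral_itv_approx => //; first lra.
    move=> s scd.
    have n1 := near b s; have n2 := near a s.
    have {}n1 h := le_trans (ler_Re_normc _) (n1 h scd).
    have {}n2 h := le_trans (ler_Re_normc _) (n2 h scd).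
    move: n1 n2; case: (f _) (f _) (f _) => [p1 q1] [p2 q2] [p3 q3] /=.
    case: (k) => k1 k2 /= n1 n2.
    have bb : a <= b <= b by rewrite lexx ?andbT (le_trans ax xb).
    have aa : a <= a <= b by rewrite lexx ?andbT (le_trans ax xb).
    have := lerD (n1 bb) (n2 aa).
    rewrite (_ : e / 2 * D + e / 2 * D = e * D); last by field.
    apply: le_trans; rewrite (le_trans _ (ler_normB _ _))// le_eqVlt; apply/orP; left.
    by apply/eqP; congr (`| _ |); ring.
  rewrite /im_contour.
  move: (\int[mu]_(x in `[a, b]) _) (\int[mu]_(x in `[c, d]) _) h1 h2 => I1 I2 h1 h2.
  have := le_trans (ler_normD _ _) (lerD h1 h2).
  rewrite (_ : _ + e * D * _ = e * D ^+ 2); last by rewrite /D; ring.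
  apply: le_trans.
  rewrite le_eqVlt; apply/orP; left; apply/eqP.
  by congr (`| _ |); ring.
Qed.

(** Cauchy's theorem for [F z = f (u * cexp z)], which is [2 pi i]-periodic,
makes the integral over the circle of radius [|u| e^s] independent of [s]; its
limit at [s = -oo] is given by the continuity of [f] at the origin. *)
Lemma mean_value f u : entire f ->
  \int[mu]_(t in `[0, pi *+ 2]) complex.Re (f (u * cexp (0 +i* t)))
  = complex.Re (f 0) * (pi *+ 2).
Proof.
move=> fe.
pose F z := f (u * cexp z).
have Fe : entire F by exact: (entire_comp fe (entireZ (@entire_cexp R))).
have pi0 : 0 <= pi *+ 2 :> R by rewrite mulrn_wge0// pi_ge0.
have per x : F (x +i* (pi *+ 2)) = F (x +i* 0).
  by rewrite /F /cexp/= sin0 cos0 sin2pi cos2pi.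
pose M s := \int[mu]_(t in `[0, pi *+ 2]) complex.Re (F (s +i* t)).
have cM s : continuous (fun t => complex.Re (F (s +i* t))).
  exact: continuous_Re_vertical.
have Mcst s : s <= 0 -> M 0 = M s.
  move=> s0.
  have E0 : \int[mu]_(x in `[s, 0])
      (complex.Im (F (x +i* 0)) - complex.Im (F (x +i* (pi *+ 2)))) = 0.
    under eq_Rintegral do rewrite per subrr.
    by rewrite Rintegral_cst// mul0r.
  have E1 : \int[mu]_(y in `[0, pi *+ 2])
      (complex.Re (F (0 +i* y)) - complex.Re (F (s +i* y))) = M 0 - M s.
    by apply: RintegralB; [exact: measurable_itv|exact: integrable_itv..].
  have := goursat Fe s0 pi0; rewrite /im_contour E0 E1 add0r => /eqP.
  by rewrite subr_eq0 => /eqP ->.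
apply/eqP; rewrite -subr_eq0 -normr_le0; apply/ler_addgt0Pl => e e0.
rewrite addr0.
have e'0 : 0 < e / (pi *+ 2) by rewrite divr_gt0// mulrn_wgt0// pi_gt0.
have [r r0 Hr] := entire_continuous fe 0 e'0.
(* On the circle of radius |u| e^s, f is within e / (2 pi) of f 0. *)
pose s : R := Num.min 0 (ln (r / (2 * (1 + normc u)))).
have nu : 0 <= normc u := normc_ge0 u.
have s0 : s <= 0 by rewrite /s ge_min lexx.
have sr : expR s * normc u < r.
  have : expR s <= r / (2 * (1 + normc u)).
    rewrite -[leRHS]lnK; first by rewrite ler_expR /s ge_min lexx orbT.
    by rewrite posrE divr_gt0// mulr_gt0// ltr_pwDl.
  rewrite ler_pdivlMr ?mulr_gt0 ?ltr_pwDl//.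
  have := expR_gt0 s; nra.
have -> : \int[mu]_(t in `[0, pi *+ 2]) complex.Re (f (u * cexp (0 +i* t))) = M s.
  exact: Mcst.
have -> : e = e / (pi *+ 2) * (pi *+ 2 - 0).
  by rewrite subr0 divfK// gt_eqF// mulrn_wgt0// pi_gt0.
rewrite -[X in `|_ - _ * X|]subr0.
apply: Rintegral_itv_approx => // t _.
have := Hr (u * cexp (s +i* t)); rewrite normcM normc_cexp/= mulrC => /(_ sr).
rewrite add0r -/(F _) => h; rewrite (le_trans _ h)//.
rewrite (le_trans _ (ler_Re_normc _))//.
by case: (F _) (f 0) => [? ?] [].
Qed.

End mean_value.

(** * Rotation invariance of area *)

Section area.
Context {R : realType}.
Local Notation mu := (@lebesgue_measure R).
Local Notation T := (measurableTypeR R).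
Local Notation RR := (T * T)%type.
Local Notation mu2 := (@lebesgue_measure R \x @lebesgue_measure R)%E.

Lemma lebesgue_measure_translate (A : set R) (c : R) : measurable A ->
  mu ((fun x : R => x + c) @^-1` A) = mu A.
Proof.
move=> mA.
have mt : measurable_fun [set: measurableTypeR R]
   ((fun x => x + c) : measurableTypeR R -> measurableTypeR R).
  exact: measurable_funD.
rewrite -[LHS]/(pushforward mu ((fun x => x + c) : _ -> measurableTypeR R) A).
apply/esym/lebesgue_measure_unique => //= _ [[a b] _ <-]; rewrite /pushforward.
have -> : (fun x : R => x + c) @^-1` `]a, b] = `]a - c, b - c]%classic.
  by apply/seteqP; split=> x /=; rewrite !in_itv/= ltrBlDr lerBrDr.
by rewrite !lebesgue_measure_itv/= !lte_fin ltrD2r -!EFinD opprB addrA subrK.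
Qed.

Definition preserves_area (p : RR -> RR) :=
  measurable_fun setT p /\ forall A, measurable A -> mu2 (p @^-1` A) = mu2 A.

Lemma preserves_area_comp p q : preserves_area p -> preserves_area q ->
  preserves_area (p \o q).
Proof.
move=> [mp pp] [mq pq]; split; first exact: measurableT_comp.
move=> A mA; rewrite comp_preimage pq; first exact: pp.
by rewrite -[X in measurable X]setTI; exact: mp.
Qed.

(** On every vertical line the shear is a translation. *)
Lemma preserves_area_shear_y (phi : T -> T) : measurable_fun setT phi ->
  preserves_area (fun p => (p.1, p.2 + phi p.1)).
Proof.
move=> mphi; split.
  apply: measurable_fun_pair => //; apply: measurable_funD => //.
  exact: measurableT_comp.
move=> A mA; rewrite /product_measure1; apply: eq_integral => x _ /=.
rewrite -(lebesgue_measure_translate (phi x) (measurable_xsection x mA)).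
congr (mu _); apply/seteqP; split => y /=; rewrite /xsection/= !inE//.
Qed.

Lemma preserves_area_shear_x (phi : T -> T) : measurable_fun setT phi ->
  preserves_area (fun p => (p.1 + phi p.2, p.2)).
Proof.
move=> mphi; have mp : measurable_fun [set: RR]
    (fun p : RR => (p.1 + phi p.2, p.2)).
  apply: measurable_fun_pair => //; apply: measurable_funD => //.
  exact: measurableT_comp.
split; first exact: mp.
move=> A mA.
have E B : measurable B -> mu2 B = (mu \x^ mu)%E B.
  by move=> mB; apply: product_measure_unique => // *; rewrite /= product_measure2E.
rewrite (E _ mA) E; last by rewrite -[X in measurable X]setTI; exact: mp.
rewrite /product_measure2; apply: eq_integral => y _ /=.
rewrite -(lebesgue_measure_translate (phi y) (measurable_ysection y mA)).
congr (mu _); apply/seteqP; split => x /=; rewrite /ysection/= !inE//.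
Qed.

Lemma preserves_area_translation (a b : R) :
  preserves_area (fun p => (p.1 + a, p.2 + b)).
Proof.
exact: (preserves_area_comp (preserves_area_shear_x (measurable_cst a))
  (preserves_area_shear_y (measurable_cst b))).
Qed.

Definition rotation (c s : R) (p : RR) : RR :=
  (c * p.1 - s * p.2, s * p.1 + c * p.2).

(** With [t = - s / (1 + c)], the rotation is the composition of the
horizontal shear of slope [t], the vertical one of slope [s] and again the
first.  The half-turn, where [1 + c] vanishes, is the square of a
quarter-turn. *)
Lemma preserves_area_rotation (c s : R) : c ^+ 2 + s ^+ 2 = 1 ->
  preserves_area (rotation c s).
Proof.
have gen c' s' : c' != -1 -> c' ^+ 2 + s' ^+ 2 = 1 ->
    preserves_area (rotation c' s').
  move=> c1 cs; have c10 : 1 + c' != 0 by rewrite addrC addr_eq0.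
  have mM k : measurable_fun [set: T] ((fun x => k * x) : T -> T) by exact: measurable_funM.
  pose t := - (s' / (1 + c')).
  have -> : rotation c' s' = (fun p => (p.1 + t * p.2, p.2)) \o
      (fun p => (p.1, p.2 + s' * p.1)) \o (fun p => (p.1 + t * p.2, p.2)).
    have ss : s' ^+ 2 = (1 - c') * (1 + c') by nra.
    have ts : t * s' = c' - 1.
      by rewrite /t mulNr mulrAC -expr2 ss mulfK// opprB.
    have tc : t * c' = - s' - t by rewrite /t; field.
    apply/funext => -[x y]; rewrite /rotation /=; congr (_, _).
      rewrite (_ : x + t * y + t * (y + s' * (x + t * y)) =
         x + t * y + t * y + (t * s') * x + (t * s') * t * y); last by ring.
      rewrite ts (_ : (c' - 1) * t = t * c' - t); last by ring.
      rewrite tc; ring.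
    rewrite (_ : y + s' * (x + t * y) = y + s' * x + t * s' * y); last by ring.
    rewrite ts; ring.
  apply: preserves_area_comp; first apply: preserves_area_comp.
  - exact: preserves_area_shear_x.
  - exact: preserves_area_shear_y.
  - exact: preserves_area_shear_x.
have [->|c1] := eqVneq c (-1); last exact: gen.
rewrite sqrrN expr1n => /(congr1 (fun u => u - 1)).
rewrite addrAC subrr add0r => /eqP; rewrite sqrf_eq0 => /eqP ->.
have r01 : preserves_area (rotation 0 1).
  by apply: gen; [rewrite eq_sym oppr_eq0 oner_eq0|rewrite expr0n expr1n add0r].
have -> : rotation (-1) 0 = rotation 0 1 \o rotation 0 1.
  by apply/funext => -[x y]; rewrite /rotation/=; congr (_, _); ring.
exact: preserves_area_comp.
Qed.

Section integral.
Local Open Scope ereal_scope.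

Let pushE p (pp : preserves_area p) (f : RR -> \bar R) :
  \int[pushforward mu2 p]_z f z = \int[mu2]_z f z.
Proof.
have [mp pe] := pp.
pose nu : {measure set (RR) -> \bar R} :=
  pushforward mu2 p.
apply: (@eq_measure_integral _ _ _ _ mu2 (nu mp)) => A mA _.
exact: pe.
Qed.

Lemma ge0_integral_preserves_area p (f : RR -> \bar R) :
  preserves_area p -> measurable_fun setT f -> (forall z, 0 <= f z) ->
  \int[mu2]_z f (p z) = \int[mu2]_z f z.
Proof.
move=> pp mf f0; have [mp _] := pp.
by rewrite -[RHS](pushE pp) ge0_integral_pushforward.
Qed.

Lemma integrable_preserves_area p (f : RR -> \bar R) :
  preserves_area p -> mu2.-integrable setT f ->
  mu2.-integrable setT (f \o p).
Proof.
move=> pp /integrableP[mf fi]; have [mp _] := pp.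
apply/integrableP; split; first exact: measurableT_comp.
rewrite (@ge0_integral_preserves_area p (abse \o f))//.
  exact: measurableT_comp.
by move=> z; exact: abse_ge0.
Qed.

Lemma integral_preserves_area p (f : RR -> \bar R) :
  preserves_area p -> mu2.-integrable setT f ->
  \int[mu2]_z f (p z) = \int[mu2]_z f z.
Proof.
move=> pp fi; have [mp _] := pp; have [mf _] := integrableP _ _ _ fi.
rewrite -[RHS](pushE pp) integral_pushforward// preimage_setT.
exact: integrable_preserves_area.
Qed.

End integral.

(** A function continuous in its first variable is the limit of the
functions obtained by rounding that variable down to a multiple of
[1 / n.+1], and these are measurable as countable gluings of functions of the
second variable. *)
Lemma measurable_separately_continuous (f : R -> R -> R) :
  (forall y, continuous (f^~ y)) -> (forall x, continuous (f x)) ->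
  measurable_fun setT (fun p : RR => f p.1 p.2).
Proof.
move=> cx cy.
pose q n (x : R) : R := (Num.floor (x * n.+1%:R))%:~R / n.+1%:R.
pose F n (p : RR) := f (q n p.1) p.2.
apply: (@measurable_fun_cvg _ _ _ _ F) => [n|[x y] _].
- move=> _ B mB; rewrite setTI.
  have -> : F n @^-1` B = \bigcup_(k in [set: int])
     (((fun x : R => Num.floor (x * n.+1%:R)) @^-1` [set k]) `*`
      (f (k%:~R / n.+1%:R) @^-1` B)).
    apply/seteqP; split=> [[x y] /= Bxy|[x y] [k _] [/= kx]].
      by exists (Num.floor (x * n.+1%:R)).
    by rewrite /F /q/= kx.
  apply: countable_bigcupT_measurable => [|k]; first exact: countableP.
  apply: measurableX; last first.
    rewrite -[X in measurable X]setTI.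
    by apply: continuous_measurable_fun.
  have -> : (fun x : R => Num.floor (x * n.+1%:R)) @^-1` [set k] =
      [set` `[k%:~R / n.+1%:R, (k + 1)%:~R / n.+1%:R[%R].
    apply/seteqP; split => x /=; rewrite in_itv/= ler_pdivrMr// ltr_pdivlMr//.
      by move=> <-; rewrite floor_le floorD1_gt.
    by move=> /floor_def.
  exact: measurable_itv.
- have cq : q n x @[n --> \oo] --> x.
    apply/cvgrPdist_lt => e e0; near=> n.
    have n0 : (0 : R) < n.+1%:R by [].
    rewrite /q -[X in `|X - _|](mulfK (lt0r_neq0 n0)) -mulrBl.
    rewrite normrM [X in _ * X]ger0_norm ?invr_ge0 ?ler0n// ltr_pdivrMr//.
    rewrite (@lt_trans _ _ 1)//.
      rewrite ger0_norm ?subr_ge0 ?floor_le// ltrBlDl.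
      by have := floorD1_gt (x * n.+1%:R); rewrite intrD.
    rewrite -ltr_pdivrMl// mulr1 (@lt_trans _ _ n%:R) ?ltr_nat//.
    by near: n; exact: nbhs_infty_gtr.
  exact: (continuous_cvg _ (cx y x) cq).
Unshelve. all: by end_near.
Qed.

Lemma sigma_finite_area : sigma_finite setT mu2.
Proof.
  pose F (n : nat) : set T := [set` `[- n%:R, n%:R]%R].
  have Fm n : measurable (F n) by exact: measurable_itv.
  exists (fun n => F n `*` F n).
    apply/esym/seteqP; split=> // -[x y] _.
    exists (Num.bound (Num.max `|x| `|y|)) => //; split; rewrite /F/= in_itv/= -ler_norml.
      by rewrite (le_trans _ (ltW (archi_boundP _)))// le_max ?lexx ?normr_ge0.
    by rewrite (le_trans _ (ltW (archi_boundP _)))// le_max ?lexx ?normr_ge0 ?orbT.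
  move=> n; split; first exact: (measurableX (Fm n) (Fm n)).
  have Fy : (mu (F n) < +oo)%E.
    by rewrite /F lebesgue_measure_itv/=; case: ifP => _; exact: ltry.
  rewrite [ltLHS]product_measure1E// lte_mul_pinfty//.
  by rewrite ge0_fin_numE.
Qed.
(** Planar Lebesgue measure under a name of its own, to which the
sigma-finiteness needed to integrate over the plane and an angle is
attached. *)
Definition area := mu2.
HB.instance Definition _ := Measure.on area.
HB.instance Definition _ := Measure_isSigmaFinite.Build _ _ _ area sigma_finite_area.

Section average.
Local Open Scope ereal_scope.

(** Rotation invariance gives [2 pi] times the left-hand side as the
integral over [t] of the integrals of the rotated copies of [P]; exchanging
the two integrals produces the averages [m]. *)
Lemma rotation_average (P m : RR -> R) : mu2.-integrable setT (EFin \o P) ->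
  (forall p, mu.-integrable `[0%R, (pi *+ 2)%R]
     (EFin \o (fun t => P (rotation (cos t) (sin t) p)))) ->
  (forall p, (\int[mu]_(t in `[0, pi *+ 2]) P (rotation (cos t) (sin t) p) =
     m p * (pi *+ 2))%R) ->
  \int[mu2]_p (P p)%:E = \int[mu2]_p (m p)%:E.
Proof.
move=> Pi Pt Pm.
have pi0 : (0 < pi *+ 2 :> R)%R by rewrite mulrn_wgt0// pi_gt0.
pose I : set R := [set` `[0%R, (pi *+ 2)%R]%R].
have muI : mu I = (pi *+ 2)%:E.
  by rewrite lebesgue_measure_itv/= lte_fin pi0 oppr0 adde0.
have intI : \int[mu]_t (\1_I t)%:E = (pi *+ 2)%:E :> \bar R.
  by rewrite integral_indic ?setIT//; exact: measurable_itv.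
pose Q (pt : RR * T) : \bar R :=
  (P (rotation (cos pt.2) (sin pt.2) pt.1) * \1_I pt.2)%:E.
have mI0 : measurable I by exact: measurable_itv.
have mI1 : measurable_fun [set: T] (\1_I : T -> R) by exact: measurable_indic.
have mP : measurable_fun setT P by apply/measurable_EFinP; exact: measurable_int Pi.
have mQ : measurable_fun setT Q.
  apply/measurable_EFinP; apply: measurable_funM; last first.
    exact: (measurableT_comp mI1 measurable_snd).
  apply: measurableT_comp => //.
  have m1 : measurable_fun setT (fun pt : RR * T => pt.1.1 : R).
    exact: measurableT_comp.
  have m2 : measurable_fun setT (fun pt : RR * T => pt.1.2 : R).
    exact: measurableT_comp.
  have mc : measurable_fun setT (fun pt : RR * T => cos pt.2 : R).
    by apply: (measurableT_comp (continuous_measurable_fun (@continuous_cos R))).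
  have ms : measurable_fun setT (fun pt : RR * T => sin pt.2 : R).
    by apply: (measurableT_comp (continuous_measurable_fun (@continuous_sin R))).
  apply: measurable_fun_pair.
    by apply: measurable_funB; exact: measurable_funM.
  by apply: measurable_funD; exact: measurable_funM.
have parea (t : R) : preserves_area (rotation (cos t) (sin t)).
  by apply: preserves_area_rotation; rewrite cos2Dsin2.
have Gabs t : \int[mu2]_p `|Q (p, t)| = (\1_I t)%:E * \int[mu2]_p `|(P p)%:E|.
  have mabs : measurable_fun setT (fun p : RR => `|(P p)%:E|).
    by apply: measurableT_comp => //; exact/measurable_EFinP.
  have abs0 (p : RR) : 0 <= `|(P p)%:E| by exact: abse_ge0.
  rewrite -(ge0_integral_preserves_area (parea t) mabs abs0).
  rewrite -ge0_integralZl//; last exact: (measurableT_comp mabs (parea t).1).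
  apply: eq_integral => p _; rewrite /Q/= normrM muleC EFinM.
  by congr (_ * _); rewrite ger0_norm.
have QI : (area \x mu).-integrable setT Q.
  apply: (integrable21ltyP area mu mQ).2; under eq_integral do rewrite Gabs.
  have [_ PI] := integrableP _ _ _ Pi.
  rewrite ge0_integralZr//; last 2 first.
  - exact/measurable_EFinP.
  - exact: integral_ge0.
  rewrite [X in X * _]intI lte_mul_pinfty//.
  by rewrite lee_fin ltW.
have FE p : fubini_F mu Q p = (m p * (pi *+ 2))%:E.
  rewrite /fubini_F -Pm /Rintegral fineK; last exact: (integrable_fin_num _ (Pt p)).
  rewrite [RHS]integral_mkcond; apply: eq_integral => t _.
  by rewrite /Q/= patchE indicE /I; case: ifP => _; rewrite ?mulr1 ?mulr0.
have GE t : fubini_G mu2 Q t = (\1_I t)%:E * \int[mu2]_p (P p)%:E.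
  rewrite -(integral_preserves_area (parea t) Pi) -integralZl//; last first.
    exact: (integrable_preserves_area (parea t) Pi).
  by apply: eq_integral => p _; rewrite /Q/= muleC EFinM.
have mI : mu2.-integrable setT (fun p => (m p * (pi *+ 2))%:E).
  by apply: eq_integrable (integrable_fubini_F QI) => // p _; rewrite FE.
have FG : \int[mu2]_p (m p * (pi *+ 2))%:E = (pi *+ 2)%:E * \int[mu2]_p (P p)%:E.
  transitivity (\int[mu2]_p fubini_F mu Q p).
    by apply: eq_integral => p _; rewrite FE.
  rewrite [LHS](Fubini QI).
  transitivity (\int[mu]_t ((\1_I t)%:E * \int[mu2]_p (P p)%:E)).
    by apply: eq_integral => t _; rewrite -GE.
  have /fineK <- := integrable_fin_num measurableT Pi.
  rewrite integralZr//; first exact: (congr1 (fun u => u * _) intI).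
  apply/integrableP; split; first exact/measurable_EFinP.
  under eq_integral do rewrite gee0_abs ?lee_fin//.
  by rewrite intI ltry.
transitivity (\int[mu2]_p ((m p * (pi *+ 2))%:E * ((pi *+ 2)^-1)%:E)); last first.
  by apply: eq_integral => p _; rewrite -EFinM mulfK// gt_eqF.
rewrite integralZr// FG; have /fineK <- := integrable_fin_num measurableT Pi.
by rewrite -!EFinM mulrAC divff ?mul1r// gt_eqF.
Qed.

End average.

Lemma integral_gauss2 :
  (\int[mu2]_p (expR (- (p.1 ^+ 2 + p.2 ^+ 2)))%:E = pi%:E :> \bar R)%E.
Proof.
rewrite fubini_tonelli1/=; last 2 first.
- apply/measurable_EFinP; apply: measurableT_comp => //.
  apply: measurableT_comp => //; apply: measurable_funD.
    by apply: measurable_funX; exact: measurable_fst.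
  by apply: measurable_funX; exact: measurable_snd.
- by move=> p; rewrite lee_fin expR_ge0.
transitivity (\int[mu]_x ((gauss_fun x)%:E * (Num.sqrt pi)%:E))%E.
  apply: eq_integral => x _; rewrite /fubini_F -integralT_gauss -ge0_integralZl//.
  - by apply: eq_integral => y _ /=; rewrite opprD expRD EFinM.
  - by apply/measurable_EFinP; exact: measurable_gauss_fun.
  - by move=> y _; rewrite lee_fin gauss_fun_ge0.
  - by rewrite lee_fin gauss_fun_ge0.
rewrite ge0_integralZr//.
- by rewrite integralT_gauss -EFinM -expr2 sqr_sqrtr// pi_ge0.
- by apply/measurable_EFinP; exact: measurable_gauss_fun.
- by move=> y _; rewrite lee_fin gauss_fun_ge0.
Qed.

End area.

(** * The RBF inner product and its reproducing kernel *)

Section rbf_space.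
Context {R : realType}.
Local Notation C := R[i].
Implicit Types (f g : C -> C) (z u w : C).
Local Notation mu := (@lebesgue_measure R).
Local Notation T := (measurableTypeR R).
Local Notation RR := (T * T)%type.
Local Notation mu2 := (@lebesgue_measure R \x @lebesgue_measure R)%E.

Lemma measurable_entire_Re f : entire f ->
  measurable_fun setT (fun p : RR => complex.Re (f (p.1 +i* p.2))).
Proof.
move=> fe; apply: (@measurable_separately_continuous R (fun x y => complex.Re (f (x +i* y)))).
  by move=> y; exact: continuous_Re_horizontal.
by move=> x; exact: continuous_Re_vertical.
Qed.

Lemma measurable_entire_Im f : entire f ->
  measurable_fun setT (fun p : RR => complex.Im (f (p.1 +i* p.2))).
Proof.
move=> fe; under eq_fun do rewrite Im_as_Re.
exact: (measurable_entire_Re (entireZ fe)).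
Qed.

(** The weight is constant on circles, so averaging over them replaces [f]
by [f 0]. *)
Lemma gaussian_mean f : entire f ->
  mu2.-integrable setT (fun p => (complex.Re (f (p.1 +i* p.2))
    * expR (- (p.1 ^+ 2 + p.2 ^+ 2)))%:E) ->
  (\int[mu2]_p (complex.Re (f (p.1 +i* p.2))
    * expR (- (p.1 ^+ 2 + p.2 ^+ 2)))%:E = (pi * complex.Re (f 0))%:E)%E.
Proof.
move=> fe fi.
pose P (p : RR) : R := complex.Re (f (p.1 +i* p.2)) * expR (- (p.1 ^+ 2 + p.2 ^+ 2)).
pose m (p : RR) : R := complex.Re (f 0) * expR (- (p.1 ^+ 2 + p.2 ^+ 2)).
have PE p t : P (rotation (cos t) (sin t) p) =
    expR (- (p.1 ^+ 2 + p.2 ^+ 2)) * complex.Re (f ((p.1 +i* p.2) * cexp (0 +i* t))).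
  rewrite /P mulrC; congr (expR (- _) * complex.Re (f _)).
    have := cos2Dsin2 t; rewrite /rotation/= => cs.
    transitivity ((cos t ^+ 2 + sin t ^+ 2) * (p.1 ^+ 2 + p.2 ^+ 2)); first by ring.
    by rewrite cs mul1r.
  by apply: complex_ext; rewrite /rotation /cexp/= expR0; ring.
have cP (p : RR) : continuous (fun t => complex.Re (f ((p.1 +i* p.2) * cexp (0 +i* t)))).
  pose F z := f ((p.1 +i* p.2) * cexp z).
  have Fe : entire F by exact: (entire_comp fe (entireZ (@entire_cexp R))).
  exact: (continuous_Re_vertical Fe).
rewrite -[LHS]/(\int[mu2]_p (P p)%:E)%E (@rotation_average _ P m fi).
- transitivity ((complex.Re (f 0))%:E *
      \int[mu2]_p (expR (- (p.1 ^+ 2 + p.2 ^+ 2)))%:E)%E.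
    rewrite -integralZl//.
    apply/integrableP; split.
      apply/measurable_EFinP; apply: measurableT_comp => //.
      apply: measurableT_comp => //; apply: measurable_funD.
        by apply: measurable_funX; exact: measurable_fst.
      by apply: measurable_funX; exact: measurable_snd.
    under eq_integral do rewrite gee0_abs ?lee_fin ?expR_ge0//.
    by rewrite integral_gauss2 ltry.
  by rewrite integral_gauss2 -EFinM mulrC.
- move=> p; under [X in EFin \o X]eq_fun do rewrite PE.
  apply: integrable_itv => t; apply: cvgM; [exact: cvg_cst|exact: cP].
- move=> p; under eq_Rintegral do rewrite PE.
  rewrite RintegralZl//; last exact: integrable_itv.
  by rewrite mean_value// /m; ring.
Qed.

Lemma inv2C : 2^-1 = (2^-1 : R)%:C.
Proof. by rewrite (fmorphV (real_complex R)) rmorph_nat. Qed.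

Lemma rbf_weightE (x y : R) : rbf_weight (x +i* y) = expR (- (2 * y ^+ 2)).
Proof.
rewrite /rbf_weight inv2C.
have -> : (x +i* y - conjc (x +i* y)) ^+ 2 * (2^-1)%:C = (- (2 * y ^+ 2))%:C.
  by apply: complex_ext => /=; field.
by rewrite cexpR.
Qed.

(** Only the real part of the hermitian product is kept: the cost is a real
quadratic function, and imaginary parts are recovered by multiplying one of
the factors by a constant. *)
Definition rbf_cross f g (p : RR) : R :=
  complex.Re (f (p.1 +i* p.2) * conjc (g (p.1 +i* p.2))) * rbf_weight (p.1 +i* p.2).

Lemma normc_sqrJ z : normc z ^+ 2 = complex.Re (z * conjc z).
Proof. by rewrite normc_sqr; case: z => a b /=; ring. Qed.

Lemma rbf_crossxx f (p : RR) : rbf_cross f f p =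
  normc (f (p.1 +i* p.2)) ^+ 2 * rbf_weight (p.1 +i* p.2).
Proof. by rewrite /rbf_cross normc_sqrJ. Qed.

Lemma rbf_crossxx_ge0 f p : 0 <= rbf_cross f f p.
Proof. by rewrite rbf_crossxx mulr_ge0 ?sqr_ge0// rbf_weightE expR_ge0. Qed.

Lemma measurable_rbf_cross f g : entire f -> entire g ->
  measurable_fun setT (rbf_cross f g).
Proof.
move=> fe ge.
have mw : measurable_fun setT (fun p : RR => rbf_weight (p.1 +i* p.2)).
  under eq_fun do rewrite rbf_weightE.
  apply: measurableT_comp => //; apply: measurableT_comp => //.
  by apply: measurable_funM => //; apply: measurable_funX; exact: measurable_snd.
have -> : rbf_cross f g = (fun p : RR =>
   (complex.Re (f (p.1 +i* p.2)) * complex.Re (g (p.1 +i* p.2)) +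
    complex.Im (f (p.1 +i* p.2)) * complex.Im (g (p.1 +i* p.2)))
   * rbf_weight (p.1 +i* p.2)).
  apply/funext => p; rewrite /rbf_cross.
  by case: (f _) (g _) => [a b] [c d] /=; rewrite mulrN opprK.
apply: measurable_funM => //; apply: measurable_funD; apply: measurable_funM.
- exact: measurable_entire_Re.
- exact: measurable_entire_Re.
- exact: measurable_entire_Im.
- exact: measurable_entire_Im.
Qed.

Lemma rbf_spaceP f : rbf_space f <->
  entire f /\ mu2.-integrable setT (EFin \o rbf_cross f f).
Proof.
have E : rbf_esqnorm f = (pi^-1%:E * \int[mu2]_p (rbf_cross f f p)%:E)%E.
  by congr (_ * _)%E; apply: eq_integral => p _; rewrite rbf_crossxx.
have pi0 : 0 < pi^-1 :> R by rewrite invr_gt0 pi_gt0.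
have I0 : (0 <= \int[mu2]_p (rbf_cross f f p)%:E)%E.
  by apply: integral_ge0 => p _; rewrite lee_fin rbf_crossxx_ge0.
split=> -[fe fi]; split => //.
- apply/integrableP; split; first by apply/measurable_EFinP; exact: measurable_rbf_cross.
  under eq_integral do rewrite /= ger0_norm ?rbf_crossxx_ge0//.
  rewrite ltNge leye_eq; apply/negP => /eqP Iy.
  by move: fi; rewrite E Iy mulry gtr0_sg// mul1e.
- have [_ fi'] := integrableP _ _ _ fi.
  rewrite E; apply: lte_mul_pinfty => //; first by rewrite lee_fin ltW.
  move: fi'; under eq_integral do rewrite /= ger0_norm ?rbf_crossxx_ge0//.
  by [].
Qed.

(** The density of the product is bounded by the sum of the densities of
the two squared norms. *)
Lemma integrable_rbf_cross f g : rbf_space f -> rbf_space g ->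
  mu2.-integrable setT (EFin \o rbf_cross f g).
Proof.
move=> /rbf_spaceP[fe fi] /rbf_spaceP[ge gi].
apply: (@le_integrable _ _ _ mu2 _ _ _
   (fun p => (rbf_cross f f p)%:E + (rbf_cross g g p)%:E)%E) => //.
- by apply/measurable_EFinP; exact: measurable_rbf_cross.
- move=> p _ /=; rewrite lee_fin [leRHS]ger0_norm ?addr_ge0 ?rbf_crossxx_ge0//.
  rewrite /rbf_cross -mulrDl normrM [X in _ * X]ger0_norm ?rbf_weightE ?expR_ge0//.
  rewrite ler_wpM2r ?expR_ge0//.
  case: (f _) (g _) => [a b] [c d] /=; rewrite ler_norml.
  have := sqr_ge0 (a + c); have := sqr_ge0 (a - c); have := sqr_ge0 (b + d).
  have := sqr_ge0 (b - d); have := sqr_ge0 a; have := sqr_ge0 b.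
  have := sqr_ge0 c; have := sqr_ge0 d => *; apply/andP; split; nra.
- exact: integrableD.
Qed.

Definition rbf_ip f g : R := (\int[mu2]_p rbf_cross f g p) / pi.

Lemma rbf_sqnormE f : rbf_space f -> rbf_sqnorm f = rbf_ip f f.
Proof.
move=> fs.
have E : rbf_esqnorm f = (pi^-1%:E * \int[mu2]_p (rbf_cross f f p)%:E)%E.
  by congr (_ * _)%E; apply: eq_integral => p _; rewrite rbf_crossxx.
rewrite /rbf_sqnorm E fineM//; first by rewrite mulrC.
exact: (integrable_fin_num measurableT (integrable_rbf_cross fs fs)).
Qed.

Lemma rbf_ipC f g : rbf_ip f g = rbf_ip g f.
Proof.
congr (_ / _); apply: eq_Rintegral => p _; rewrite /rbf_cross; congr (_ * _).
by case: (f _) (g _) => [a b] [c d] /=; ring.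
Qed.

Lemma rbf_ipDl f g k : rbf_space f -> rbf_space g -> rbf_space k ->
  rbf_ip (fun z => f z + g z) k = rbf_ip f k + rbf_ip g k.
Proof.
move=> fs gs ks; rewrite /rbf_ip -mulrDl -RintegralD//; last 2 first.
- exact: integrable_rbf_cross.
- exact: integrable_rbf_cross.
congr (_ / _); apply: eq_Rintegral => p _; rewrite /rbf_cross.
by rewrite [X in complex.Re X]mulrDl raddfD mulrDl.
Qed.

Lemma rbf_spaceZ (c : C) f : rbf_space f -> rbf_space (fun z => c * f z).
Proof.
move=> /rbf_spaceP[fe fi]; apply/rbf_spaceP; split; first exact: entireZ.
have -> : EFin \o rbf_cross (fun z => c * f z) (fun z => c * f z) =
   (fun p => (normc c ^+ 2)%:E * (EFin \o rbf_cross f f) p)%E.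
  apply/funext => p /=; rewrite -EFinM; congr EFin; rewrite !rbf_crossxx normcM; ring.
exact: integrableZl.
Qed.

Lemma rbf_spaceD f g : rbf_space f -> rbf_space g -> rbf_space (fun z => f z + g z).
Proof.
move=> fs gs; have /rbf_spaceP[fe fi] := fs; have /rbf_spaceP[ge gi] := gs.
apply/rbf_spaceP; split; first exact: entireD.
have -> : EFin \o rbf_cross (fun z => f z + g z) (fun z => f z + g z) =
   ((EFin \o rbf_cross f f) \+ ((EFin \o rbf_cross f g) \+
    (EFin \o rbf_cross f g)) \+ (EFin \o rbf_cross g g))%E.
  apply/funext => p /=; rewrite -!EFinD; congr EFin; rewrite /rbf_cross.
  case: (f _) (g _) => [a b] [c d] /=; ring.
apply: integrableD => //; apply: integrableD => //.
by apply: integrableD => //; exact: integrable_rbf_cross.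
Qed.

Lemma ReMr z (x : R) : complex.Re (z * x%:C) = complex.Re z * x.
Proof. by case: z => a b /=; ring. Qed.

Lemma entire_kernel w : entire (fun z => rbf_kernel z w).
Proof.
have e1 : entire (fun z : C => - 2^-1 * ((z + - conjc w) * (z + - conjc w))).
  have d : entire (fun z : C => z + - conjc w).
    exact: (entireD (@entire_id R) (@entire_cst R _)).
  exact: (@entireZ R _ _ (entireM d d)).
have -> : (fun z => rbf_kernel z w) =
    @cexp R \o (fun z : C => - 2^-1 * ((z + - conjc w) * (z + - conjc w))).
  by apply/funext => z; rewrite /rbf_kernel /=; congr cexp; rewrite expr2; ring.
exact: (entire_comp (@entire_cexp R) e1).
Qed.

(** Here [z = w + u] with [u = x +i* y]: the conjugate of the kernel
contributes [conj(u)] terms which the weight turns into a holomorphic factor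
times the Gaussian in [u]. *)
Lemma kernel_density (x y p q : R) :
  let z := (x + p) +i* (y + q) in let w := p +i* q in
  conjc (rbf_kernel z w) * (rbf_weight z)%:C =
  cexp ((x +i* y) ^+ 2 / 2 + (0 +i* (2 * q)) * (x +i* y))
  * (expR (- (x ^+ 2 + y ^+ 2)))%:C.
Proof.
move=> z w; rewrite /z rbf_weightE /rbf_kernel cexp_conj -!cexpR -!cexpD.
by congr cexp; rewrite /w inv2C; apply: complex_ext => /=; field.
Qed.

Lemma kernel_sqr_density (x y p q : R) :
  let z := (x + p) +i* (y + q) in let w := p +i* q in
  normc (rbf_kernel z w) ^+ 2 * rbf_weight z =
  expR (2 * q ^+ 2) * expR (- (x ^+ 2 + y ^+ 2)).
Proof.
move=> z w; rewrite /z rbf_weightE /rbf_kernel normc_cexp -expRM_natl -!expRD.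
by congr expR; rewrite /w inv2C /=; field.
Qed.

Lemma rbf_space_kernel w : rbf_space (fun z => rbf_kernel z w).
Proof.
apply/rbf_spaceP; split; first exact: entire_kernel.
case: w => p q.
set k := (fun z => rbf_kernel z (p +i* q)).
have ke : entire k := @entire_kernel (p +i* q).
have mk : measurable_fun setT (fun v : RR => (rbf_cross k k v)%:E).
  by apply/measurable_EFinP; exact: measurable_rbf_cross.
apply/integrableP; split; first exact: mk.
under eq_integral do rewrite /= ger0_norm ?rbf_crossxx_ge0//.
rewrite -(ge0_integral_preserves_area (preserves_area_translation p q) mk); last first.
  by move=> v; rewrite lee_fin rbf_crossxx_ge0.
under eq_integral do rewrite rbf_crossxx /= /k kernel_sqr_density EFinM.
rewrite ge0_integralZl//.
- by rewrite integral_gauss2 -EFinM ltry.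
- apply/measurable_EFinP; apply: measurableT_comp => //.
  apply: measurableT_comp => //; apply: measurable_funD.
    by apply: measurable_funX; exact: measurable_fst.
  by apply: measurable_funX; exact: measurable_snd.
Qed.

(** After translating by [w], the integrand is an entire function times
the Gaussian, whose average is the value at the origin. *)
Lemma rbf_ip_kernel f w : rbf_space f ->
  rbf_ip f (fun z => rbf_kernel z w) = complex.Re (f w).
Proof.
case: w => p q fs; have [fe _] := (rbf_spaceP f).1 fs.
set k := (fun z => rbf_kernel z (p +i* q)).
have ks : rbf_space k by exact: rbf_space_kernel.
pose F u := f (u + (p +i* q)) * cexp (u ^+ 2 / 2 + (0 +i* (2 * q)) * u).
have Fe : entire F.
  have s1 : entire (fun u : C => u + (p +i* q)).
    exact: (entireD (@entire_id R) (@entire_cst R _)).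
  have s2 : entire (fun u : C => 2^-1 * (u * u) + (0 +i* (2 * q)) * u).
    exact: (entireD (@entireZ R _ _ (entireM (@entire_id R) (@entire_id R)))
      (@entireZ R _ _ (@entire_id R))).
  have -> : F = (fun u => (f \o (fun u => u + (p +i* q))) u *
      (@cexp R \o (fun u : C => 2^-1 * (u * u) + (0 +i* (2 * q)) * u)) u).
    by apply/funext => u; rewrite /F /= expr2 [_ / 2]mulrC.
  exact: (entireM (entire_comp fe s1) (entire_comp (@entire_cexp R) s2)).
pose t (v : RR) : RR := (v.1 + p, v.2 + q).
have FE : (fun v => (rbf_cross f k (t v))%:E) = (fun v => (complex.Re (F (v.1 +i* v.2))
    * expR (- (v.1 ^+ 2 + v.2 ^+ 2)))%:E).
  apply/funext => -[x y]; congr EFin; rewrite /rbf_cross /=.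
  by rewrite -ReMr -mulrA kernel_density mulrA ReMr.
have ti := integrable_preserves_area (preserves_area_translation p q)
  (integrable_rbf_cross fs ks).
have E := integral_preserves_area (preserves_area_translation p q)
  (integrable_rbf_cross fs ks).
rewrite /rbf_ip /Rintegral -[X in fine X]E.
rewrite -[X in fine X]/(\int[mu2]_v (rbf_cross f k (t v))%:E)%E FE.
rewrite gaussian_mean//; last by rewrite -FE; exact: ti.
rewrite /= /F add0r mulrC mulKf ?gt_eqF ?pi_gt0//.
rewrite expr0n/= mul0r mulr0 addr0 cexp0 mulr1//.
Qed.

Lemma rbf_ipDr f g k : rbf_space f -> rbf_space g -> rbf_space k ->
  rbf_ip k (fun z => f z + g z) = rbf_ip k f + rbf_ip k g.
Proof. by move=> fs gs ks; rewrite !(rbf_ipC k) rbf_ipDl. Qed.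

Lemma rbf_ip_sesqui (c : C) f g :
  rbf_ip f (fun z => c * g z) = rbf_ip (fun z => conjc c * f z) g.
Proof.
congr (_ / _); apply: eq_Rintegral => p _; rewrite /rbf_cross; congr (_ * _).
by congr complex.Re; rewrite rmorphM/=; ring.
Qed.

Lemma rbf_ipZl (t : R) f g : rbf_space f -> rbf_space g ->
  rbf_ip (fun z => t%:C * f z) g = t * rbf_ip f g.
Proof.
move=> fs gs; rewrite /rbf_ip mulrA -RintegralZl//; last exact: integrable_rbf_cross.
congr (_ / _); apply: eq_Rintegral => p _; rewrite /rbf_cross mulrA; congr (_ * _).
by case: (f _) (g _) => [a b] [a' b'] /=; ring.
Qed.

Lemma rbf_sqnorm_ge0 f : rbf_space f -> 0 <= rbf_sqnorm f.
Proof.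
move=> fs; rewrite rbf_sqnormE// divr_ge0 ?pi_ge0// Rintegral_ge0// => p _.
exact: rbf_crossxx_ge0.
Qed.

Lemma rbf_sqnormD f g : rbf_space f -> rbf_space g ->
  rbf_sqnorm (fun z => f z + g z) = rbf_sqnorm f + 2 * rbf_ip g f + rbf_sqnorm g.
Proof.
move=> fs gs; have fgs := rbf_spaceD fs gs.
rewrite !rbf_sqnormE// rbf_ipDl// !rbf_ipDr// (rbf_ipC f g); ring.
Qed.

Lemma rbf_sqnormZ (t : R) f : rbf_space f ->
  rbf_sqnorm (fun z => t%:C * f z) = t ^+ 2 * rbf_sqnorm f.
Proof.
move=> fs; have tfs := rbf_spaceZ t%:C fs.
by rewrite !rbf_sqnormE// rbf_ipZl// rbf_ipC rbf_ipZl// mulrA.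
Qed.

(** A degenerate case of the Cauchy-Schwarz inequality: a vector of zero
norm is orthogonal to the kernels, hence vanishes everywhere by the
reproducing property. *)
Lemma rbf_sqnorm_eq0 g : rbf_space g -> rbf_sqnorm g = 0 -> forall x, g x = 0.
Proof.
move=> gs g0 x; pose k z := g x * rbf_kernel z x.
have ks : rbf_space k by apply: rbf_spaceZ; exact: rbf_space_kernel.
have B : rbf_ip g k = normc (g x) ^+ 2.
  rewrite rbf_ip_sesqui rbf_ip_kernel; last exact: rbf_spaceZ.
  by rewrite normc_sqrJ mulrC.
have A0 := rbf_sqnorm_ge0 ks.
have [/eqP|B0] := eqVneq (normc (g x) ^+ 2) 0.
  by rewrite sqrf_eq0 => /eqP /eq0_normc.
(* For this t the squared norm of k + t g would be -1. *)
pose t : R := - (rbf_sqnorm k + 1) / (2 * normc (g x) ^+ 2).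
have := rbf_sqnorm_ge0 (rbf_spaceD ks (rbf_spaceZ t%:C gs)).
rewrite rbf_sqnormD//; last exact: rbf_spaceZ.
rewrite rbf_ipZl// B rbf_sqnormZ// g0 mulr0 addr0.
rewrite (_ : 2 * (t * _) = - (rbf_sqnorm k + 1)); last first.
  by move: B0; rewrite /t; move: (normc _ ^+ 2) => b b0; field.
by move=> A1; exfalso; lra.
Qed.

End rbf_space.

(** * The learning problem for combinations of kernels *)

Section learning.
Context {R : realType}.
Local Notation C := R[i].
Implicit Types (f g : C -> C) (z u w : C).

Lemma rbf_space_kernel_comb (I : Type) (r : seq I) (c z : I -> C) :
  rbf_space (fun x => \sum_(j <- r) c j * rbf_kernel x (z j)).
Proof.
elim: r => [|j r IH].
  under eq_fun => x do rewrite big_nil -(mul0r (rbf_kernel x 0)).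
  exact: (rbf_spaceZ 0 (rbf_space_kernel 0)).
under eq_fun do rewrite big_cons.
by apply: rbf_spaceD => //; apply: rbf_spaceZ; exact: rbf_space_kernel.
Qed.

Lemma rbf_ip_kernel_comb (I : Type) (r : seq I) (c z : I -> C) g : rbf_space g ->
  rbf_ip g (fun x => \sum_(j <- r) c j * rbf_kernel x (z j)) =
  \sum_(j <- r) complex.Re (conjc (c j) * g (z j)).
Proof.
move=> gs; elim: r => [|j r IH].
  rewrite big_nil; under [X in rbf_ip g X]eq_fun do rewrite big_nil.
  rewrite /rbf_ip; under eq_Rintegral do rewrite /rbf_cross conjc0 mulr0 mul0r.
  by rewrite Rintegral_cst// !mul0r.
rewrite big_cons -IH; under [X in rbf_ip g X]eq_fun do rewrite big_cons.
rewrite rbf_ipDr//; last 2 first.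
- by apply: rbf_spaceZ; exact: rbf_space_kernel.
- exact: rbf_space_kernel_comb.
by rewrite rbf_ip_sesqui rbf_ip_kernel//; exact: rbf_spaceZ.
Qed.

Lemma normc_sqrB (d e : C) :
  normc (d - e) ^+ 2 = normc d ^+ 2 - 2 * complex.Re (conjc d * e) + normc e ^+ 2.
Proof. by rewrite !normc_sqr; case: d e => [a b] [a' b'] /=; ring. Qed.

(** The squared norm contributes the product of [g] with the kernel
combination [f], which is again a combination of the values [g (z k)]; both
linear terms merge. *)
Lemma rbf_cost_expand n (lambda : R) (c z w : 'I_n.+1 -> C) g : rbf_space g ->
  let f := fun x => \sum_(j < n.+1) c j * rbf_kernel x (z j) in
  rbf_cost lambda z w (fun x => f x + g x) =
  rbf_cost lambda z w f
  - 2 * \sum_k complex.Re (conjc (w k - f (z k) - lambda%:C * c k) * g (z k))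
  + (\sum_k normc (g (z k)) ^+ 2 + lambda * rbf_sqnorm g).
Proof.
move=> gs f; have fs : rbf_space f by exact: rbf_space_kernel_comb.
rewrite /rbf_cost rbf_sqnormD// rbf_ip_kernel_comb//.
under eq_bigr do rewrite opprD addrA normc_sqrB.
rewrite !big_split/= sumrN -mulr_sumr.
have -> : \sum_(k < n.+1) complex.Re (conjc (w k - f (z k) - lambda%:C * c k) * g (z k))
  = \sum_(k < n.+1) complex.Re (conjc (w k - f (z k)) * g (z k))
   - lambda * \sum_(k < n.+1) complex.Re (conjc (c k) * g (z k)).
  rewrite mulr_sumr -sumrB; apply: eq_bigr => k _.
  by case: (w k) (f _) (c k) (g _) => [? ?] [? ?] [? ?] [? ?] /=; ring.
ring.
Qed.

Lemma kernel_comb_minimizes n (lambda : R) (c z w : 'I_n.+1 -> C) : 0 < lambda ->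
  let f := fun x => \sum_(j < n.+1) c j * rbf_kernel x (z j) in
  (forall k, w k = f (z k) + lambda%:C * c k) ->
  solves_learning_problem lambda z w f.
Proof.
move=> l0 f wE; have fs : rbf_space f by exact: rbf_space_kernel_comb.
have Jg g : rbf_space g -> rbf_cost lambda z w (fun x => f x + g x) =
    rbf_cost lambda z w f + (\sum_k normc (g (z k)) ^+ 2 + lambda * rbf_sqnorm g).
  move=> gs; rewrite rbf_cost_expand// big1 ?mulr0 ?subr0// => k _.
  have d0 : w k - f (z k) - lambda%:C * c k = 0 by rewrite wE; ring.
  by rewrite -/(f (z k)) d0 conjc0 mul0r.
have sum0 g : 0 <= \sum_k normc (g (z k)) ^+ 2.
  by apply: sumr_ge0 => k _; exact: sqr_ge0.
have dec y : rbf_space y -> exists2 g, rbf_space g & y = (fun x => f x + g x).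
  move=> ys; exists (fun x => y x + (-1) * f x); first exact/rbf_spaceD/rbf_spaceZ.
  by apply/funext => x; ring.
apply/seteqP; split => [y [/dec[g gs ->] /(_ f fs)]|_ ->].
  rewrite Jg// gerDl => Q0.
  have N0 : rbf_sqnorm g = 0.
    apply/eqP; rewrite eq_le rbf_sqnorm_ge0// andbT -(pmulr_rle0 _ l0).
    by have := sum0 g; lra.
  by apply/funext => x /=; rewrite (rbf_sqnorm_eq0 gs N0) addr0.
split => // y /dec[g gs ->]; rewrite Jg// lerDl addr_ge0//.
by rewrite mulr_ge0 ?rbf_sqnorm_ge0// ltW.
Qed.

Lemma cexp_exp (x : C) m : cexp x ^+ m = cexp (m%:R * x).
Proof.
elim: m => [|m IH]; first by rewrite expr0 mul0r cexp0.
by rewrite exprS IH -cexpD; congr cexp; rewrite -(natr1 m); ring.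
Qed.

(** Multiplying the Gaussian [e^{- x^2 / 2}] by [e^{i m x}] gives, up to a
constant, the kernel at the point [- i m]. *)
Lemma rbf_space_gauss_poly (p : {poly C}) :
  rbf_space (fun x => cexp (- (x ^+ 2 / 2)) * p.[cexp ('i * x)]).
Proof.
have -> : (fun x => cexp (- (x ^+ 2 / 2)) * p.[cexp ('i * x)]) =
    (fun x => \sum_(m < size p)
      (p`_m * (expR (- (m%:R ^+ 2 / 2)))%:C) * rbf_kernel x (0 -i* m%:R)).
  apply/funext => x.
rewrite horner_coef mulr_sumr; apply: eq_bigr => m _.
  rewrite cexp_exp /rbf_kernel -cexpR [LHS]mulrCA -cexpD -[RHS]mulrA -cexpD.
  congr (_ * cexp _); rewrite !inv2C.
  have -> : (m%:R : C) = (m%:R : R)%:C by rewrite rmorph_nat.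
  by case: x => x y; apply: complex_ext => /=; field.
exact: (rbf_space_kernel_comb _ (fun m : 'I_(size p) => p`_m * (expR (- (m%:R ^+ 2 / 2)))%:C)
  (fun m : 'I_(size p) => 0 -i* m%:R)).
Qed.

(** Lagrange interpolation in the variable [e^{i x}], multiplied by the
nowhere vanishing factor [e^{- x^2 / 2}] so as to stay in the space. *)
Lemma rbf_interpolation n (z : 'I_n -> C) : injective (fun j => cexp ('i * z j)) ->
  forall k (d : C), exists2 g, rbf_space g &
    g (z k) = d /\ forall j, j != k -> g (z j) = 0.
Proof.
move=> zI k d.
pose p : {poly C} := \prod_(j < n | j != k) ('X - (cexp ('i * z j))%:P).
pose e x := cexp (- (x ^+ 2 / 2)) * p.[cexp ('i * x)].
have ek : e (z k) != 0.
  rewrite mulf_neq0//.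
    apply/eqP => /(congr1 (@normc R)); rewrite normc_cexp normc0.
    by apply/eqP; rewrite gt_eqF ?expR_gt0.
  rewrite horner_prod prodf_seq_neq0; apply/allP => j _; apply/implyP => jk.
  by rewrite hornerXsubC subr_eq0; apply: contra jk => /eqP/zI ->.
exists (fun x => (d / e (z k)) * e x); first exact/rbf_spaceZ/rbf_space_gauss_poly.
split; first by rewrite divfK.
move=> j jk; suff -> : e (z j) = 0 by rewrite mulr0.
by rewrite /e horner_prod (bigD1 j)//= hornerXsubC subrr mul0r mulr0.
Qed.

(** Perturbing [f] along a function [g] of the space equal to
[d = w k - f (z k) - lambda * c k] at [z k] and to zero at the other points,
the cost varies by [- 2 t |d|^2 + O(t^2)], which is nonnegative for all real
[t] only if [d = 0]. *)
Lemma kernel_comb_outputs_unique n (lambda : R) (c z w : 'I_n.+1 -> C) : 0 < lambda ->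
  injective (fun j => cexp ('i * z j)) ->
  let f := fun x => \sum_(j < n.+1) c j * rbf_kernel x (z j) in
  solves_learning_problem lambda z w f ->
  forall k, w k = f (z k) + lambda%:C * c k.
Proof.
move=> l0 zI f sf k; have fs : rbf_space f by exact: rbf_space_kernel_comb.
have [_ fmin] : argmin_set rbf_space (rbf_cost lambda z w) f by rewrite sf.
set d := w k - f (z k) - lambda%:C * c k.
suff d0 : d = 0.
  by apply/eqP; rewrite -subr_eq0 opprD addrA -/d d0.
have [g gs [gk gj]] := rbf_interpolation zI k d.
pose Q := \sum_k normc (g (z k)) ^+ 2 + lambda * rbf_sqnorm g.
have Q0 : 0 <= Q.
  rewrite addr_ge0//; last by rewrite mulr_ge0 ?rbf_sqnorm_ge0// ltW.
  by apply: sumr_ge0 => j _; exact: sqr_ge0.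
pose L := normc d ^+ 2.
have L0 : 0 <= L by exact: sqr_ge0.
have H (t : R) : 0 <= - 2 * t * L + t ^+ 2 * Q.
  have tgs := rbf_spaceZ t%:C gs.
  have E : rbf_cost lambda z w (fun x => f x + t%:C * g x) = _ :=
    rbf_cost_expand lambda c z w tgs.
  have := fmin (fun x => f x + t%:C * g x) (rbf_spaceD fs tgs).
  rewrite E -/f -addrA lerDl rbf_sqnormZ//.
  rewrite (bigD1 k)//= [X in complex.Re _ + X]big1 => [|j jk]; last first.
    by rewrite gj// !mulr0.
  rewrite gk -/d addr0.
  under [X in _ + (X + _)]eq_bigr do rewrite normcM exprMn.
  rewrite -mulr_sumr.
  have -> : normc t%:C ^+ 2 = t ^+ 2 by rewrite normc_sqr /= expr0n addr0.
  have -> : complex.Re (conjc d * (t%:C * d)) = t * L.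
    by rewrite /L normc_sqr; case: (d) => a b /=; ring.
  by congr (0 <= _); rewrite /Q; ring.
(* A nearly optimal t; the 1 avoids a discussion of the case Q = 0. *)
have := H (L / (Q + 1)).
have Q1 : 0 < Q + 1 by lra.
rewrite (_ : _ + _ = - (L ^+ 2 * (Q + 2)) / (Q + 1) ^+ 2); last by field; lra.
rewrite ler_pdivlMr ?exprn_gt0// mul0r oppr_ge0 pmulr_lle0; last by lra.
move=> LL; have /eqP : L ^+ 2 = 0 by apply/eqP; rewrite eq_le LL sqr_ge0.
by rewrite sqrf_eq0 /L sqrf_eq0 => /eqP/eq0_normc.
Qed.

End learning.

(** * The output sets of the superoscillations *)

Theorem theorem4p16 (R : realType) (n : nat) (a lambda : R)
    (h : nat -> nat -> R) (Z : nat -> nat -> R -> R[i]) :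
  1 < a -> 0 < lambda ->
  sup [set `|h j n| | j in `I_n.+1] <= 1 ->
  let z := fun k : 'I_n.+1 => rbf_point h n k in
  let w1 := fun k : 'I_n.+1 =>
    (expR (h k n ^+ 2 / 2))%:C
      * (\sum_(j < n.+1) Z j n a * (expR (h k n * h j n))%:C)
    + lambda%:C * Z k n a * (expR (- (h k n ^+ 2 / 2)))%:C in
  let w2 := fun k : 'I_n.+1 =>
    (expR (h k n ^+ 2 / 2))%:C
      * (\sum_(j < n.+1) Z j n a
                         * (expR (h j n ^+ 2 / 2 + h k n * h j n))%:C)
    + lambda%:C * Z k n a in
  (solves_learning_problem lambda z w1 (rbf_superosc1 h Z n a) /\
   (injective z -> forall w : 'I_n.+1 -> R[i],
      solves_learning_problem lambda z w (rbf_superosc1 h Z n a) -> w = w1))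
  /\
  (solves_learning_problem lambda z w2 (rbf_superosc2 h Z n a) /\
   (injective z -> forall w : 'I_n.+1 -> R[i],
      solves_learning_problem lambda z w (rbf_superosc2 h Z n a) -> w = w2)).
Proof.
move=> _ l0 _ z w1 w2.
have zexp : injective z -> injective (fun j => cexp ('i * z j)).
  move=> zI j k; rewrite /z /rbf_point.
  have E (t : R) : 'i * (0 -i* t) = t%:C by apply: complex_ext => /=; ring.
  rewrite !E !cexpR => /complexI/expR_inj hjk.
  by apply: zI; rewrite /z /rbf_point hjk.
have kE (k j : 'I_n.+1) : rbf_kernel (z k) (z j) =
    (expR (h k n ^+ 2 / 2))%:C * (expR (h j n ^+ 2 / 2))%:C * (expR (h k n * h j n))%:C.
  rewrite -!cexpR -!cexpD /rbf_kernel /z /rbf_point inv2C; congr cexp.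
  by apply: complex_ext => /=; field.
have eN (t : R) : (expR (- t))%:C * (expR t)%:C = 1.
  by rewrite -!cexpR -cexpD -rmorphD addNr cexp0.
have w1E k : w1 k = rbf_superosc1 h Z n a (z k) +
    lambda%:C * (Z k n a * (expR (- (h k n ^+ 2 / 2)))%:C).
  rewrite /w1 /rbf_superosc1 mulrA; congr (_ + _); rewrite mulr_sumr.
  apply: eq_bigr => j _; rewrite kE.
  rewrite -[LHS]mulr1 -(eN (h j n ^+ 2 / 2)); ring.
have w2E k : w2 k = rbf_superosc2 h Z n a (z k) + lambda%:C * Z k n a.
  rewrite /w2 /rbf_superosc2; congr (_ + _); rewrite mulr_sumr.
  apply: eq_bigr => j _; rewrite kE -!cexpR rmorphD cexpD; ring.
split; split.
- exact: kernel_comb_minimizes.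
- move=> /zexp zI w ws; apply/funext => k; rewrite w1E.
  exact: (kernel_comb_outputs_unique
    (c := fun j : 'I_n.+1 => Z j n a * (expR (- (h j n ^+ 2 / 2)))%:C) l0 zI ws).
- exact: kernel_comb_minimizes.
- move=> /zexp zI w ws; apply/funext => k; rewrite w2E.
  exact: (kernel_comb_outputs_unique (c := fun j : 'I_n.+1 => Z j n a) l0 zI ws).
Qed.
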